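(* Let $\alpha=\big((\alpha_1^+,\alpha_1^-),\ldots,(\alpha_n^+,\alpha_n^-)\big)$ be a degree sequence (a sequence of integer pairs) in positive lexicographical order. There is a digraph $G$ which realizes $\alpha$ if and only if $\sum_{i=1}^n\alpha_i^+=\sum_{i=1}^n\alpha_i^-$ and for every $k$ with $1\le k<n$ \[ \sum_{i=1}^k\min(\alpha_i^-,k-1)+\sum_{i=k+1}^n\min(\alpha_i^-,k)\ge\sum_{i=1}^k\alpha_i^+. \]
   Context: A digraph $G=(V,E)$ is loopless, and $E$ is a set of ordered pairs of distinct vertices, called arcs (both $(v,w)$ and $(w,v)$ may be present). The out-degree $d^+(v)$ is the number of arcs $(v,w)$, and the in-degree $d^-(v)$ is the number of arcs $(w,v)$. A digraph $G$ realizes $\alpha$ if its vertex set is $\{v_1,\ldots,v_n\}$ and $d^+(v_i)=\alpha_i^+$, $d^-(v_i)=\alpha_i^-$ for all $i$. Here ''degree sequence'' refers to a given sequence of integer pairs, not assumed in advance to be realized by a digraph. The sequence $\alpha$ is in positive lexicographical order if, for every $1\le i<n$, $\alpha_i^+\ge\alpha_{i+1}^+$, and moreover $\alpha_i^-\ge\alpha_{i+1}^-$ whenever $\alpha_i^+=\alpha_{i+1}^+$.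
   Formalization: The formal theorem additionally assumes 0 ≤ α_i^- ≤ n−1 for all i; for arbitrary integer pairs the statement fails, e.g. n = 1 and α = ((1,1)) satisfies all the conditions but no loopless digraph realizes it. Every realizable sequence satisfies the added bounds. *)

(* Defs.v *)
(* MathComp *)
From HB Require Import structures.
From mathcomp Require Import all_boot all_order all_algebra.

Set Implicit Arguments.
Unset Strict Implicit.
Unset Printing Implicit Defensive.

Import Order.TTheory GRing.Theory Num.Theory.
Local Open Scope ring_scope.

Record digraph := Digraph {
  vertex : finType;
  arcs : {set vertex * vertex};
  arcs_loopless : forall v : vertex, (v, v) \notin arcs }.

Definition outdeg (G : digraph) (v : vertex G) : nat :=
  #|[set a in arcs G | a.1 == v]|.

Definition indeg (G : digraph) (v : vertex G) : nat :=
  #|[set a in arcs G | a.2 == v]|.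

(* A sequence of pairs is a function alpha on 'I_n; the term alpha_(i+1) is
   alpha i, with out-degree component (alpha i).1 and in-degree component
   (alpha i).2. *)

(* The bijection v enumerates the vertex set of G as v_1, ..., v_n. *)
Definition realizes (n : nat) (G : digraph) (alpha : 'I_n -> int * int) : Prop :=
  exists2 v : 'I_n -> vertex G, bijective v &
    forall i : 'I_n,
      (outdeg (v i))%:Z = (alpha i).1 /\ (indeg (v i))%:Z = (alpha i).2.

Definition pos_lex_order (n : nat) (alpha : 'I_n -> int * int) : Prop :=
  forall i j : 'I_n, j = i.+1 :> nat ->
    (alpha j).1 <= (alpha i).1 /\
    ((alpha i).1 = (alpha j).1 -> (alpha j).2 <= (alpha i).2).

(* Main.v *)
Require Import Defs.
From mathcomp Require Import all_boot all_order all_algebra.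
From mathcomp Require Import zify.
Set Implicit Arguments.
Unset Strict Implicit.
Unset Printing Implicit Defensive.

Import Order.TTheory GRing.Theory Num.Theory.
Local Open Scope ring_scope.

(** With [S] a set of [k] vertices, writing
    [min(a_j^-, |S \ j|) = min(a_j^-, k) - [j \in S and a_j^- >= k]] turns the
    condition [\sum_(i in S) a_i^+ <= \sum_j min(a_j^-, |S \ j|)] into an upper
    bound on the sum over [S] of the weights [a_i^+ + [a_i^- >= k]].  In positive
    lexicographical order these weights are nonincreasing, so the inequality for
    the first [k] vertices implies it for all [S].  The condition for all [S] is
    sufficient by an exchange argument: among the arc sets with the prescribed
    in-degrees, one minimizing the total excess of the out-degrees has none, as
    otherwise either some alternating path lowers the excess, or the vertices not
    reachable from a vertex in excess form a set [S] violating the condition. *)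

(** * Arc sets, their degrees and the necessary inequality *)

Section ArcSets.
Local Open Scope nat_scope.
Variable T : finType.
Implicit Types (A : {set T * T}) (S : {set T}).

Definition loopless A := forall v, (v, v) \notin A.
Definition out_degree A i := \sum_j ((i, j) \in A).
Definition in_degree A j := \sum_i ((i, j) \in A).

Lemma sum_out_degree A S :
  \sum_(i in S) out_degree A i = \sum_j \sum_(i in S) ((i, j) \in A).
Proof. exact: exchange_big. Qed.

Lemma sum_out_degree_eq_in A : \sum_i out_degree A i = \sum_j in_degree A j.
Proof. exact: exchange_big. Qed.

(** The tails in [S] of arcs into [j] are among all tails of such arcs and, without loops, among
    [S :\ j]. *)
Lemma sum_in_degree_le A S j : loopless A ->
  \sum_(i in S) ((i, j) \in A) <= minn (in_degree A j) #|S :\ j|.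
Proof.
move=> lA; rewrite leq_min; apply/andP; split.
  by rewrite /in_degree [X in _ <= X](bigID (mem S)) /= leq_addr.
rewrite -sum1_card big_mkcond [X in _ <= X]big_mkcond /=.
apply: leq_sum => i _; rewrite !inE; have [->|_] := eqVneq i j.
  by rewrite (negbTE (lA j)); case: ifP.
by case: ifP => //= _; apply: leq_b1.
Qed.

Lemma out_degree_bound A S : loopless A ->
  \sum_(i in S) out_degree A i <= \sum_j minn (in_degree A j) #|S :\ j|.
Proof.
move=> lA; rewrite sum_out_degree.
by apply: leq_sum => j _; apply: sum_in_degree_le.
Qed.

(** * Exchanging arcs along alternating paths *)

Definition shiftable A : rel T :=
  fun i i' => [exists j, [&& (i, j) \in A, (i', j) \notin A & i' != j]].

(** For a [j] witnessing [shiftable A i i'], this switches an alternating path of length two: one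
    unit of out-degree passes from [i] to [i']. *)
Definition shift A i i' j := (i', j) |: (A :\ (i, j)).

Lemma in_shift A i i' j x y : ((x, y) \in shift A i i' j) =
  (y == j) && (x == i') || ~~ ((y == j) && (x == i)) && ((x, y) \in A).
Proof. by rewrite !inE !xpair_eqE ![_ && (y == j)]andbC. Qed.

Section Shift.
Variables (A : {set T * T}) (i i' j : T).
Hypotheses (Aij : (i, j) \in A) (nAi'j : (i', j) \notin A) (i'Nj : i' != j).

Let i'Ni : i' != i.
Proof. by apply/eqP=> e; case/negP: nAi'j; rewrite e. Qed.

Lemma shift_loopless : loopless A -> loopless (shift A i i' j).
Proof.
move=> lA v; rewrite in_shift (negbTE (lA v)) andbF orbF.
by apply/negP => /andP[/eqP-> /eqP ji']; case/eqP: i'Nj.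
Qed.

Lemma in_degree_shift y : in_degree (shift A i i' j) y = in_degree A y.
Proof.
rewrite /in_degree; have [->|yNj] := eqVneq y j; last first.
  by apply: eq_bigr => x _; rewrite in_shift (negbTE yNj).
rewrite (bigD1 i) //= (bigD1 i') //= [RHS](bigD1 i) //= [in RHS](bigD1 i') //=.
rewrite !in_shift !eqxx Aij (negbTE nAi'j) [i == i']eq_sym (negbTE i'Ni) /=.
rewrite addnCA; congr (_ + (_ + _)); apply: eq_bigr => x /andP[xNi xNi'].
by rewrite in_shift (negbTE xNi) (negbTE xNi') andbF.
Qed.

(** Stated without subtraction, which truncates on [nat]. *)
Lemma out_degree_shift x :
  out_degree (shift A i i' j) x + (x == i) = out_degree A x + (x == i').
Proof.
rewrite /out_degree (bigD1 j) //= [in RHS](bigD1 j) //= in_shift eqxx /=.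
rewrite -!addnA ![\sum_(_ | _) _ + _]addnC !addnA; congr (_ + _); last first.
  by apply: eq_bigr => y /negbTE yNj; rewrite in_shift yNj.
have [->|_] := eqVneq x i'; first by rewrite (negbTE nAi'j) (negbTE i'Ni).
by have [->|_] := eqVneq x i; rewrite ?Aij.
Qed.

(** Only rows [i] and [i'] change, and row [i'] only grows, so [x] may be [i'] but [z] may not. *)
Lemma shiftable_shift x z : x != i -> z != i -> z != i' ->
  shiftable A x z -> shiftable (shift A i i' j) x z.
Proof.
move=> /negbTE xNi /negbTE zNi /negbTE zNi' /existsP[y /and3P[Axy nAzy zNy]].
apply/existsP; exists y; rewrite !in_shift xNi zNi zNi' !andbF /= Axy orbT.
by rewrite nAzy.
Qed.

End Shift.

(* On a simple path, shifting along the first edge keeps the other edges: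
   it changes no row of the remaining path but the first, which only grows. *)
Lemma shift_path p A u : loopless A -> path (shiftable A) u p -> uniq (u :: p) ->
  exists B, [/\ loopless B, forall j, in_degree B j = in_degree A j &
    forall i, out_degree B i + (i == u) = out_degree A i + (i == last u p)].
Proof.
elim: p A u => [|u1 p IHp] A u lA; first by exists A.
case/andP=> /existsP[j /and3P[Auj nAu1j u1Nj]] u1p /andP[uNp Up].
have u1p' : path (shiftable (shift A u u1 j)) u1 p.
  move: uNp Up u1p; case: (p) => //= u2 q.
  rewrite !inE !negb_or => /and3P[uNu1 uNu2 uNq] /andP[/andP[u1Nu2 u1Nq] _].
  (* The edge leaving [u1] is handled apart; all later edges avoid both changed rows. *)
  case/andP=> u1u2 u2q; rewrite shiftable_shift // 1?eq_sym //=.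
  apply: (sub_in_path (P := predC (pred2 u u1))) u2q => [x z|].
    rewrite !inE !negb_or => /andP[xNu _] /andP[zNu zNu1].
    exact: shiftable_shift.
  apply/allP=> x; rewrite !inE negb_or => /orP[/eqP->|qx].
    by rewrite ![u2 == _]eq_sym uNu2.
  apply/andP; split; first by apply: contraNneq uNq => <-.
  by apply: contraNneq u1Nq => <-.
have [B [lB inB outB]] := IHp _ _ (shift_loopless u u1Nj lA) u1p' Up.
exists B; split=> // [y|x]; first by rewrite inB in_degree_shift.
have := out_degree_shift Auj nAu1j x; have := outB x => /=; lia.
Qed.


(** * Sufficiency by reducing the excess *)

Lemma exists_in_degree (g : T -> nat) : (forall j, g j < #|T|) ->
  exists2 A, loopless A & forall j, in_degree A j = g j.
Proof.
(* The first [g j] vertices other than [j] are the tails of the arcs into [j]. *)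
move=> g_lt; exists [set a | a.1 \in take (g a.2) (enum [set~ a.2])].
  move=> v; rewrite inE /=; apply: contraTN isT => /mem_take.
  by rewrite mem_enum !inE eqxx.
move=> j; rewrite /in_degree.
under eq_bigr => i _ do rewrite inE /=.
rewrite -big_mkcond sum1_card (card_uniqP _) ?take_uniq ?enum_uniq //.
by rewrite size_takel // -cardE cardsC1; have := g_lt j; lia.
Qed.

(** Truncated subtraction counts only the surplus over [f], never a deficit. *)
Definition excess (f : T -> nat) A := \sum_i (out_degree A i - f i).

(** One unit of out-degree moves from a vertex with a surplus to one with a deficit, where it
    creates no excess. *)
Lemma excess_decrease (f : T -> nat) A u w : loopless A ->
  f u < out_degree A u -> out_degree A w < f w -> connect (shiftable A) u w ->
  exists B, [/\ loopless B, forall j, in_degree B j = in_degree A j &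
    excess f B < excess f A].
Proof.
move=> lA fu fw /connectP[p0 p0_path w_last].
case: (shortenP p0_path) w_last => p p_path p_uniq _ w_last.
have [B [lB inB outB]] := shift_path lA p_path p_uniq.
exists B; split=> //; rewrite -w_last in outB.
have uNw : u != w by apply/eqP=> e; rewrite e in fu; lia.
rewrite /excess (bigD1 u) //= [ltnRHS](bigD1 u) //= -addSn leq_add //.
  by have := outB u; rewrite eqxx (negbTE uNw); lia.
apply: leq_sum => i /negbTE iNu; have := outB i; rewrite iNu.
by case: eqP => [->|_]; lia.
Qed.

Theorem digraph_factor (f g : T -> nat) :
  (forall j, g j < #|T|) -> \sum_i f i = \sum_j g j ->
  (forall S, \sum_(i in S) f i <= \sum_j minn (g j) #|S :\ j|) ->
  exists A, [/\ loopless A, forall i, out_degree A i = f i &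
    forall j, in_degree A j = g j].
Proof.
move=> g_lt fg_sum f_le.
have [A lA inA] := exists_in_degree g_lt.
have [m] := ubnP (excess f A); elim: m => // m IHm in A lA inA *.
have out_sum : \sum_i out_degree A i = \sum_i f i.
  by rewrite sum_out_degree_eq_in fg_sum; apply: eq_bigr.
have [/existsP[u fu] Am|noex _] := boolP [exists u, f u < out_degree A u].
  pose S := [set w | ~~ connect (shiftable A) u w].
  have [/existsP[w /andP[uw fw]]|no_w] :=
      boolP [exists w, connect (shiftable A) u w && (out_degree A w < f w)].
    have [B [lB inB exB]] := excess_decrease lA fu fw uw.
    by apply: (IHm B lB) => [j|]; rewrite ?inB //; lia.
  (* If a vertex outside [S] has an arc to [j], so does each vertex of [S :\ j], or it would be
     reachable; otherwise all arcs into [j] start in [S]. *)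
  have out_geS : \sum_j minn (g j) #|S :\ j| <= \sum_(i in S) out_degree A i.
    rewrite sum_out_degree; apply: leq_sum => j _; rewrite geq_min -inA.
    have [/existsP[i /andP[uNi Aij]]|noi] :=
        boolP [exists i, (i \notin S) && ((i, j) \in A)].
      apply/orP; right; rewrite -sum1_card big_mkcond [leqRHS]big_mkcond /=.
      apply: leq_sum => i' _; rewrite in_setD1; case: eqP => //= /eqP i'Nj.
      case: ifP => // Si'; case: (boolP ((i', j) \in A)) => // nAi'j.
      move: uNi Si'; rewrite !inE negbK => ui /negP[].
      apply: connect_trans ui (connect1 _).
      by apply/existsP; exists j; rewrite Aij nAi'j.
    apply/orP; left; rewrite /in_degree (bigID (mem S)) /=.
    rewrite [X in _ + X]big1 ?addn0 //.
    move=> i iNS; case: (boolP ((i, j) \in A)) => // Aij.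
    by case/existsP: noi; exists i; rewrite iNS.
  have out_gt : \sum_(i in ~: S) f i < \sum_(i in ~: S) out_degree A i.
    have uS : u \in ~: S by rewrite !inE negbK connect0.
    rewrite (bigD1 u) //= [ltnRHS](bigD1 u) //= -addSn leq_add //.
    apply: leq_sum => i /andP[]; rewrite !inE negbK => ui _.
    by move/existsPn: no_w => /(_ i); rewrite ui /= -leqNgt.
  (* The out-degrees sum to at least the sum of [f] on [S] and to more outside, against the equal
     totals. *)
  have := f_le S; move: out_sum.
  rewrite (bigID (mem S)) /= [RHS](bigID (mem S)) /=.
  have inC h : \sum_(i in ~: S) h i = \sum_(i | i \notin S) h i.
    by apply: eq_bigl => i; rewrite inE.
  by move: out_gt; rewrite 2!inC; lia.
have out_le i : out_degree A i <= f i.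
  by move/existsPn: noex => /(_ i); rewrite -leqNgt.
exists A; split=> // i; apply/eqP; move: out_sum => /eqP.
by rewrite (leqif_sum (fun i _ => leqif_eq (out_le i))) => /forallP /(_ i).
Qed.

End ArcSets.

(** * Digraphs as arc sets on the indices *)

Lemma Posz_sum (I : Type) (r : seq I) (P : pred I) (F : I -> nat) :
  (\sum_(i <- r | P i) F i)%N%:Z = \sum_(i <- r | P i) (F i)%:Z.
Proof. exact: (big_morph Posz PoszD). Qed.

Lemma outdegE (G : digraph) (v : vertex G) : outdeg v = out_degree (arcs G) v.
Proof.
rewrite /outdeg -sum1_card; under eq_bigl => a do rewrite inE andbC.
rewrite -[RHS](@big_pred1_eq nat 0%N addn _ v (out_degree (arcs G))) pair_big.
rewrite big_mkcondr.
by apply: eq_big => -[i j] /=; rewrite ?andbT //; case: ifP.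
Qed.

Lemma indegE (G : digraph) (v : vertex G) : indeg v = in_degree (arcs G) v.
Proof.
rewrite /indeg -sum1_card; under eq_bigl => a do rewrite inE andbC.
rewrite -[RHS](@big_pred1_eq nat 0%N addn _ v (in_degree (arcs G))).
rewrite exchange_big pair_big big_mkcondr.
by apply: eq_big => -[i j] //=; case: ifP.
Qed.

(** Pulling arcs back along the enumeration makes the indices the vertices. *)
Lemma realizable_iff (n : nat) (alpha : 'I_n -> int * int) :
  (exists G : digraph, realizes G alpha) <->
  exists A : {set 'I_n * 'I_n}, [/\ loopless A,
    forall i, (out_degree A i)%:Z = (alpha i).1 &
    forall i, (in_degree A i)%:Z = (alpha i).2].
Proof.
split=> [[G [v v_bij degv]]|[A [lA outA inA]]]; last first.
  exists (Digraph lA), id; first by exists id.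
  by move=> i; rewrite outdegE indegE.
exists [set a | (v a.1, v a.2) \in arcs G]; split=> [i|i|i].
- by rewrite inE arcs_loopless.
- rewrite -(degv i).1 outdegE /out_degree; congr Posz.
  rewrite [RHS](reindex v) /=; last exact: onW_bij.
  by apply: eq_bigr => j _; rewrite inE.
- rewrite -(degv i).2 indegE /in_degree; congr Posz.
  rewrite [RHS](reindex v) /=; last exact: onW_bij.
  by apply: eq_bigr => j _; rewrite inE.
Qed.

(** * Comparing arbitrary sets with prefixes *)

Section Prefix.
Variable n : nat.
Implicit Types S : {set 'I_n}.

Definition prefix_set (k : nat) : {set 'I_n} := [set i : 'I_n | (i < k)%N].

Lemma card_prefix_set k : (k <= n)%N -> #|prefix_set k| = k.
Proof.
move=> kn; rewrite -sum1_card; under eq_bigl => i do rewrite inE.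
by rewrite -(big_ord_widen n (fun=> 1%N)) // sum1_card card_ord.
Qed.

Lemma sum_le_prefix (w : 'I_n -> int) S :
  (forall i j : 'I_n, (i <= j)%N -> w j <= w i) ->
  \sum_(i in S) w i <= \sum_(i in prefix_set #|S|) w i.
Proof.
move=> w_mono; have Sn : (#|S| <= n)%N by rewrite -[leqRHS]card_ord max_card.
have [/cards0_eq->|S_gt0] := posnP #|S|.
  by rewrite cards0 !big1 // => i; rewrite inE.
have lt_n : (#|S|.-1 < n)%N by rewrite prednK.
(* Relative to the last prefix weight, terms are nonnegative on the prefix and nonpositive beyond
   it; equal cardinality cancels the shift. *)
pose c := w (Ordinal lt_n).
have sum_sub (X : {set 'I_n}) : #|X| = #|S| ->
    \sum_(i in X) w i = \sum_(i in X) (w i - c) + c *+ #|S|.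
  by move=> <-; rewrite sumrB sumr_const subrK.
rewrite !sum_sub ?card_prefix_set // lerD2r big_mkcond [leRHS]big_mkcond /=.
apply: ler_sum => i _; rewrite inE; have [iS|Si] := ltnP i #|S|.
  by case: ifP => // _; rewrite subr_ge0 w_mono // -ltnS prednK.
by case: ifP => // _; rewrite subr_le0 w_mono //= (leq_trans (leq_pred _)).
Qed.

(** Between neighbours the first component either drops by at least one, which absorbs the
    indicator, or stays equal, and then the second does not increase. *)
Lemma pos_lex_weight (alpha : 'I_n -> int * int) (k : int) (i j : 'I_n) :
  pos_lex_order alpha -> (i <= j)%N ->
  (alpha j).1 + (k <= (alpha j).2)%R%:Z <=
  (alpha i).1 + (k <= (alpha i).2)%R%:Z.
Proof.
move=> alpha_lex /subnK; move: (j - i)%N => m.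
elim: m j => [|m IHm] j; first by rewrite add0n => /ord_inj->.
rewrite addSn => ij; have jm_lt : (m + i < n)%N by have := ltn_ord j; lia.
apply: le_trans (IHm (Ordinal jm_lt) erefl).
have [] := alpha_lex (Ordinal jm_lt) j (esym ij).
by case: (leP k (alpha j).2); case: leP; lia.
Qed.

(** Removing [j] from the prefix leaves [k - 1] elements if [j < k], and [k] otherwise. *)
Lemma sum_min_prefix (g : 'I_n -> int) (k : nat) : (k <= n)%N ->
  \sum_(i < n | (i < k)%N) Num.min (g i) (k%:Z - 1) +
  \sum_(i < n | (k <= i)%N) Num.min (g i) k%:Z =
  \sum_j Num.min (g j) #|prefix_set k :\ j|%:Z.
Proof.
move=> kn; rewrite [RHS](bigID (fun i : 'I_n => (i < k)%N)) /=.
have cardD1 (j : 'I_n) : (k = (j < k) + #|prefix_set k :\ j|)%N.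
  by rewrite -{1}(card_prefix_set kn) (cardsD1 j) inE.
congr (_ + _).
  by apply: eq_bigr => j jk; have := cardD1 j; rewrite jk /=; lia.
apply: eq_big => [j|j kj]; first by rewrite leqNgt.
by have := cardD1 j; rewrite ltnNge kj /=; lia.
Qed.

Lemma sum_min_setD1 (g : 'I_n -> int) S :
  \sum_j Num.min (g j) #|S :\ j|%:Z =
  \sum_j Num.min (g j) #|S|%:Z - \sum_(i in S) (#|S|%:Z <= g i)%R%:Z.
Proof.
rewrite [X in _ - X]big_mkcond -sumrB; apply: eq_bigr => j _.
rewrite (cardsD1 j S); case: (j \in S) => /=; last by rewrite subr0 add0n.
by rewrite add1n; move: #|_ :\ _| (g j) => m x; case: leP => /= gm; lia.
Qed.
End Prefix.

(** In-degrees of a digraph on [n] vertices satisfy [alpha_range], which makes up for the absent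
    case [k = n]: the single pair (1, 1) meets the other conditions, yet only a loop could realize
    it. *)
Theorem theorem5 (n : nat) (alpha : 'I_n -> int * int)
  (alpha_range : forall i : 'I_n, 0 <= (alpha i).2 <= n%:Z - 1)
  (alpha_lex : pos_lex_order alpha) :
  (exists G : digraph, realizes G alpha) <->
  (\sum_(i < n) (alpha i).1 = \sum_(i < n) (alpha i).2 /\
   forall k : nat, (1 <= k < n)%N ->
     \sum_(i < n | (i < k)%N) Num.min (alpha i).2 (k%:Z - 1) +
     \sum_(i < n | (k <= i)%N) Num.min (alpha i).2 k%:Z
       >= \sum_(i < n | (i < k)%N) (alpha i).1).
Proof.
have sum_prefix (h : 'I_n -> int) k :
    \sum_(i < n | (i < k)%N) h i = \sum_(i in prefix_set n k) h i.
  by apply: eq_bigl => i; rewrite inE.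
rewrite realizable_iff; split=> [[A [lA outA inA]]|[alpha_sum alpha_le]].
  split.
    under eq_bigr => i _ do rewrite -outA.
    under [RHS]eq_bigr => i _ do rewrite -inA.
    by rewrite -!Posz_sum sum_out_degree_eq_in.
  move=> k /andP[k_gt0 kn]; rewrite sum_min_prefix 1?ltnW // sum_prefix.
  under eq_bigr => i _ do rewrite -outA.
  under [leRHS]eq_bigr => j _ do rewrite -inA.
  have := out_degree_bound (prefix_set n k) lA; rewrite -lez_nat !Posz_sum.
  move=> le_out; apply: le_trans le_out _; apply: ler_sum => j _.
  by move: #|_| (in_degree A j) => m d; lia.
have fS (S : {set 'I_n}) : \sum_(i in S) (alpha i).1 <=
    \sum_j Num.min (alpha j).2 #|S :\ j|%:Z.
  have Sn : (#|S| <= n)%N by rewrite -[leqRHS]card_ord max_card.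
  (* For the full set each minimum is the in-degree itself, being at most [n - 1], so the equality
     of the sums suffices. *)
  have [/eqP Sn_eq|Sn_ne] := boolP (#|S| == n).
    have -> : S = setT.
      by apply/eqP; rewrite eqEcard subsetT cardsT card_ord Sn_eq /=.
    under eq_bigl => i do rewrite inE.
    rewrite alpha_sum; apply: ler_sum => j _.
    have := cardsD1 j setT; have := alpha_range j.
    by rewrite cardsT card_ord inE /=; move: #|_| => m; lia.
  have [/cards0_eq S0|S_gt0] := posnP #|S|.
    rewrite S0 big_set0; apply: sumr_ge0 => j _; have := alpha_range j; lia.
  have kn : (1 <= #|S| < n)%N by lia.
  have := alpha_le _ kn; rewrite sum_min_prefix // sum_prefix.
  (* With the indicators moved to the left, hypothesis and goal share their right-hand side. *)
  rewrite !sum_min_setD1 card_prefix_set // !lerBrDr -!big_split /=.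
  by apply: le_trans; apply: sum_le_prefix => i j; apply: pos_lex_weight.
have g_ge0 i : 0 <= (alpha i).2 by case/andP: (alpha_range i).
(* By [fS], the first components other than that of [i] sum to at most the total of the in-degrees,
   which is the total of all first components. *)
have f_ge0 i : 0 <= (alpha i).1.
  rewrite -(lerD2r (\sum_(j in [set~ i]) (alpha j).1)) add0r.
  have -> : (alpha i).1 + \sum_(j in [set~ i]) (alpha j).1 = \sum_j (alpha j).2.
    rewrite -alpha_sum [RHS](bigD1 i) //=; congr (_ + _).
    by apply: eq_bigl => j; rewrite !inE.
  by apply: le_trans (fS _) _; apply: ler_sum => j _; rewrite ge_min lexx.
have [||| A [lA outA inA]] := @digraph_factor _ (fun i => `|(alpha i).1|%N)
    (fun j => `|(alpha j).2|%N).
- by move=> j; rewrite card_ord; have := alpha_range j; lia.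
- apply/eqP; rewrite -eqz_nat !Posz_sum; apply/eqP.
  under eq_bigr => i _ do rewrite gez0_abs //.
  under [RHS]eq_bigr => j _ do rewrite gez0_abs //.
  exact: alpha_sum.
- move=> S; rewrite -lez_nat !Posz_sum.
  under eq_bigr => i _ do rewrite gez0_abs //.
  apply: le_trans (fS S) _; apply: ler_sum => j _.
  by have := g_ge0 j; move: #|_| (alpha j).2 => m x /=; lia.
exists A; split=> // i.
  by rewrite outA; have := f_ge0 i; lia.
by rewrite inA; have := alpha_range i; lia.
Qed.
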